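(* Let $G=\mathbb{Z}/3\mathbb{Z}\star\mathbb{Z}/3\mathbb{Z}$, with $a$ and $b$ generators of the two cyclic factors, and let $\Sigma=\{a,a^2,b,b^2\}$. Let $p,q\ge 0$ with $0<p+q<1$ and let $\mu$ be the probability measure with $\mu(a)=p$, $\mu(a^2)=q$, $\mu(b)=\mu(b^2)=(1-p-q)/2$. Then the drift (with respect to $\Sigma$) of the random walk $(G,\mu)$ is $$\gamma=2(1-p-q)\sqrt{\frac{p^2+q^2+pq}{p^2+q^2-2pq+3}}.$$
   Context: Random walk $(G,\mu)$: $X_0=1$, $X_{n+1}=X_nx_n$ with $(x_n)$ i.i.d. of law $\mu$. The length $|g|$ of $g\in G$ is its word length with respect to $\Sigma$ (equivalently, the number of letters in its free-product normal form), and the drift is $\gamma=\lim_n|X_n|/n$ (a.s.). *)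

(* Defs.v *)
From HB Require Import structures.
From mathcomp Require Import all_boot all_order all_algebra.
From mathcomp Require Import all_fingroup all_solvable.
From mathcomp Require Import all_classical all_reals all_analysis.

Set Implicit Arguments.
Unset Strict Implicit.
Unset Printing Implicit Defensive.

Import Order.TTheory GRing.Theory Num.Theory.
Import numFieldNormedType.Exports.

Local Open Scope classical_set_scope.
Local Open Scope group_scope.

(* The free product H * K, carried by the normal forms: words over H + K whose
   letters are nontrivial and come alternately from the two factors. *)
Section FreeProductDef.
Variables H K : groupType.

Definition fp_nontriv (l : H + K) : bool :=
  match l with inl h => h != 1 | inr k => k != 1 end.

Definition fp_alt (l m : H + K) : bool :=
  match l, m with inl _, inr _ | inr _, inl _ => true | _, _ => false end.

Definition fp_reduced (w : seq (H + K)) : bool :=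
  all fp_nontriv w && sorted fp_alt w.

Definition free_product : Type := {w : seq (H + K) | fp_reduced w}.

HB.instance Definition _ := Choice.on free_product.

Definition fp_cons (l : H + K) (w : seq (H + K)) : seq (H + K) :=
  if fp_nontriv l then l :: w else w.

(* Left multiplication of a normal form by an arbitrary (possibly trivial)
   letter, put back in normal form. *)
Definition fp_lmul (l : H + K) (w : seq (H + K)) : seq (H + K) :=
  match l, w with
  | inl h, inl h' :: w' => fp_cons (inl (h * h')) w'
  | inr k, inr k' :: w' => fp_cons (inr (k * k')) w'
  | _, _ => fp_cons l w
  end.

Definition fp_linv (l : H + K) : H + K :=
  match l with inl h => inl h^-1 | inr k => inr k^-1 end.

Definition fp_mulw (u v : seq (H + K)) : seq (H + K) := foldr fp_lmul v u.

Definition fp_invw (u : seq (H + K)) : seq (H + K) := rev (map fp_linv u).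

Lemma fp_reduced_cons l w :
  fp_reduced (l :: w) =
  [&& fp_nontriv l, (if w is m :: _ then fp_alt l m else true) & fp_reduced w].
Proof.
rewrite /fp_reduced /=; case: w => [|m w] /=; first by rewrite !andbT.
by rewrite -!andbA; congr (_ && _); do !bool_congr.
Qed.

Lemma fp_reduced_lmul l w : fp_reduced w -> fp_reduced (fp_lmul l w).
Proof.
case: w => [|m w]; first by case: l => x _; rewrite /= /fp_cons /=;
  case: ifP => //; rewrite fp_reduced_cons /= => ->.
case: l m => x [] y; rewrite [in fp_lmul _ _]/= /fp_cons;
  case: ifP => // xP; rewrite !fp_reduced_cons ?xP /=;
  case: w => [|[] z w] //; by case/and3P.
Qed.

Lemma fp_reduced_mulw u v : fp_reduced v -> fp_reduced (fp_mulw u v).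
Proof. by move=> rv; elim: u => //= l u; apply: fp_reduced_lmul. Qed.

Lemma fp_reduced_invw u : fp_reduced u -> fp_reduced (fp_invw u).
Proof.
case/andP=> nu su; apply/andP; split.
  rewrite all_rev all_map; apply: sub_all nu => -[] x /=;
  by rewrite invg_eq1.
rewrite rev_sorted sorted_map; apply: sub_sorted su.
by move=> [] x [] y.
Qed.

Lemma fp_lmull1 w : fp_reduced w -> fp_lmul (inl 1) w = w.
Proof.
case: w => [|[] x w]; rewrite ?fp_reduced_cons /= /fp_cons /= ?eqxx //.
by rewrite mul1g; case/andP=> ->.
Qed.

Lemma fp_lmulr1 w : fp_reduced w -> fp_lmul (inr 1) w = w.
Proof.
case: w => [|[] x w]; rewrite ?fp_reduced_cons /= /fp_cons /= ?eqxx //.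
by rewrite mul1g; case/andP=> ->.
Qed.

Lemma fp_lmullM x y w : fp_reduced w ->
  fp_lmul (inl x) (fp_lmul (inl y) w) = fp_lmul (inl (x * y)) w.
Proof.
case: w => [|[z|z] w]; rewrite /= /fp_cons /=.
- by case: (eqVneq y 1) => [->|] //=; rewrite mulg1.
- rewrite fp_reduced_cons => /and3P[nz az rw].
  case: (eqVneq (y * z) 1) => [e|] /=; last by rewrite mulgA.
  have -> : x * y * z = x by rewrite -mulgA e mulg1.
  by case: w az rw => [|[]] //.
- by case: (eqVneq y 1) => [->|] //=; rewrite mulg1.
Qed.

Lemma fp_lmulrM x y w : fp_reduced w ->
  fp_lmul (inr x) (fp_lmul (inr y) w) = fp_lmul (inr (x * y)) w.
Proof.
case: w => [|[z|z] w]; rewrite /= /fp_cons /=.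
- by case: (eqVneq y 1) => [->|] //=; rewrite mulg1.
- by case: (eqVneq y 1) => [->|] //=; rewrite mulg1.
- rewrite fp_reduced_cons => /and3P[nz az rw].
  case: (eqVneq (y * z) 1) => [e|] /=; last by rewrite mulgA.
  have -> : x * y * z = x by rewrite -mulgA e mulg1.
  by case: w az rw => [|[]] //.
Qed.

Lemma fp_mulw_cons l v w : fp_reduced w ->
  fp_mulw (fp_cons l v) w = fp_lmul l (fp_mulw v w).
Proof.
move=> rw; rewrite /fp_cons; case: ifPn => // /negbTE nl.
have r := fp_reduced_mulw v rw.
by case: l nl => x /negbFE/eqP->; rewrite ?fp_lmull1 ?fp_lmulr1.
Qed.

Lemma fp_mulw_lmul l v w : fp_reduced w ->
  fp_mulw (fp_lmul l v) w = fp_lmul l (fp_mulw v w).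
Proof.
move=> rw; have r v' := fp_reduced_mulw v' rw.
case: l v => x [|[y|y] v]; rewrite [fp_lmul _ _ in LHS]/= fp_mulw_cons //.
- by rewrite -fp_lmullM.
- by rewrite -fp_lmulrM.
Qed.

Lemma fp_mulwA u v w : fp_reduced w ->
  fp_mulw u (fp_mulw v w) = fp_mulw (fp_mulw u v) w.
Proof. by move=> rw; elim: u => //= l u IHu; rewrite fp_mulw_lmul // IHu. Qed.

Lemma fp_mulw1 u : fp_reduced u -> fp_mulw u [::] = u.
Proof.
elim: u => //= l u IHu; rewrite fp_reduced_cons => /and3P[nl al ru].
by rewrite IHu //; case: l u nl al {IHu ru} => x [|[y|y] u] /= nx ax //;
  rewrite /fp_cons /= nx.
Qed.

Lemma fp_mulVw u : fp_mulw (fp_invw u) u = [::].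
Proof.
elim: u => //= l u; rewrite /fp_invw /= rev_cons -cats1 /fp_mulw foldr_cat /=.
by case: l => x; rewrite /= mulVg /fp_cons /= eqxx.
Qed.

Lemma fp_invwK u : fp_invw (fp_invw u) = u.
Proof.
rewrite /fp_invw map_rev revK -map_comp map_id_in // => -[] x _ /=;
by rewrite invgK.
Qed.

Definition fp_one : free_product := Sub [::] isT.
Definition fp_inv (u : free_product) : free_product :=
  Sub (fp_invw (val u)) (fp_reduced_invw (valP u)).
Definition fp_mul (u v : free_product) : free_product :=
  Sub (fp_mulw (val u) (val v)) (fp_reduced_mulw (val u) (valP v)).

Lemma fp_mulA : associative fp_mul.
Proof. by move=> u v w; apply: val_inj; apply: fp_mulwA (valP w). Qed.
Lemma fp_mul1 : left_id fp_one fp_mul.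
Proof. by move=> u; apply: val_inj. Qed.
Lemma fp_mulr1 : right_id fp_one fp_mul.
Proof. by move=> u; apply: val_inj; apply: fp_mulw1 (valP u). Qed.
Lemma fp_mulV : left_inverse fp_one fp_inv fp_mul.
Proof. by move=> u; apply: val_inj; apply: fp_mulVw. Qed.
Lemma fp_mulrV : right_inverse fp_one fp_inv fp_mul.
Proof.
by move=> u; apply: val_inj; rewrite /= -{1}(fp_invwK (val u)) fp_mulVw.
Qed.

HB.instance Definition _ := isGroup.Build free_product
  fp_mulA fp_mul1 fp_mulr1 fp_mulV fp_mulrV.

(* The discrete sigma-algebra. *)
HB.instance Definition _ := isPointed.Build free_product fp_one.
HB.instance Definition _ := @isMeasurable.Build default_measure_display
  free_product discrete_measurable discrete_measurable0
  discrete_measurableC discrete_measurableU.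

Lemma fp_reduced_letter (l : H + K) : fp_reduced (fp_cons l [::]).
Proof. by case: l => x; rewrite /fp_cons /fp_reduced /=; case: ifP => //= ->. Qed.

Definition fp_letter (l : H + K) : free_product :=
  Sub (fp_cons l [::]) (fp_reduced_letter l).

Definition fp_inl (h : H) : free_product := fp_letter (inl h).
Definition fp_inr (k : K) : free_product := fp_letter (inr k).

Lemma fp_inlM : {morph fp_inl : x y / x * y}.
Proof.
move=> x y; apply: val_inj; rewrite [RHS]fp_mulw_cons ?fp_reduced_letter //.
exact/esym/(fp_lmullM x y (w := [::])).
Qed.

Lemma fp_inrM : {morph fp_inr : x y / x * y}.
Proof.
move=> x y; apply: val_inj; rewrite [RHS]fp_mulw_cons ?fp_reduced_letter //.
exact/esym/(fp_lmulrM x y (w := [::])).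
Qed.

Lemma fp_prod_letters (u : free_product) :
  u = \prod_(l <- val u) fp_letter l.
Proof.
have E w : fp_reduced w -> val (\prod_(l <- w) fp_letter l) = w.
  elim: w => [_|l w IHw rlw]; first by rewrite big_nil.
  have := rlw; rewrite fp_reduced_cons => /and3P[_ _ rw].
  rewrite big_cons /= IHw // fp_mulw_cons //= -[RHS]fp_mulw1 //=.
  by rewrite fp_mulw1.
by apply: val_inj; rewrite E //; apply: valP.
Qed.

(* Universal property: free_product is the coproduct of H and K. *)
Lemma free_product_universal (L : groupType) (f : H -> L) (g : K -> L) :
  {morph f : x y / x * y} -> {morph g : x y / x * y} ->
  exists! phi : free_product -> L,
    [/\ {morph phi : u v / u * v},
        forall h, phi (fp_inl h) = f h & forall k, phi (fp_inr k) = g k].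
Proof.
move=> fM gM.
have f1 : f 1 = 1 by apply: (mulgI (f 1)); rewrite -fM !mulg1.
have g1 : g 1 = 1 by apply: (mulgI (g 1)); rewrite -gM !mulg1.
pose e (l : H + K) := match l with inl h => f h | inr k => g k end.
pose E (w : seq (H + K)) := \prod_(l <- w) e l.
have Econs l w : E (fp_cons l w) = e l * E w.
  rewrite /fp_cons; case: ifPn => [_|]; first by rewrite /E big_cons.
  by case: l => x /= /negPn/eqP ->; rewrite (f1, g1) mul1g.
have Elmul l w : E (fp_lmul l w) = e l * E w.
  by case: l w => x [|[y|y] w] /=; rewrite Econs //= /E big_cons
    ?fM ?gM ?mulgA.
exists (fun u => E (val u)); split=> [|psi [psiM psil psir]].
  split=> [u v|h|k] /=; last 2 first.
  - by rewrite Econs /E big_nil mulg1.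
  - by rewrite Econs /E big_nil mulg1.
  elim: (val u) => [|l w IHw] /=; first by rewrite /E big_nil mul1g.
  by rewrite Elmul IHw [E (l :: w)]/E big_cons mulgA.
apply/funext => u; rewrite [in RHS](fp_prod_letters u) /E.
have psi1 : psi 1 = 1 by apply: (mulgI (psi 1)); rewrite -psiM !mulg1.
elim: (val u) => [|l w IHw]; first by rewrite !big_nil psi1.
rewrite !big_cons psiM IHw; congr (_ * _).
by case: l => x; [exact/esym/psil|exact/esym/psir].
Qed.

End FreeProductDef.

Arguments fp_inl {H K}.
Arguments fp_inr {H K}.

(* The least n such that g is a product of n elements of S; the junk value 0
   is used when g is not such a product. Inverses of elements of S are not
   added: this is the usual word length when S = S^-1. *)
Definition word_length (G : groupType) (S : set G) (g : G) : nat :=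
  let P n := `[< exists s : seq G,
    [/\ size s = n, forall y, y \in s -> S y & \prod_(y <- s) y = g] >] in
  if pselect (exists n, P n) is left exP then ex_minn exP else 0%N.

Fixpoint random_walk (G : groupType) (Omega : Type) (x : nat -> Omega -> G)
    (n : nat) (w : Omega) : G :=
  if n is m.+1 then random_walk x m w * x m w else 1.

Definition mutually_independent d d' (Omega : measurableType d)
    (E : measurableType d') (R : realType) (P : probability Omega R)
    (x : nat -> {RV P >-> E}) : Prop :=
  forall (J : seq nat) (A : nat -> set E),
    uniq J -> (forall j, measurable (A j)) ->
    P (\bigcap_(j in [set` J]) (x j @^-1` A j)) =
    (\prod_(j <- J) P (x j @^-1` A j))%E.

Definition iid_of_law d d' (Omega : measurableType d)
    (E : measurableType d') (R : realType) (P : probability Omega R)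
    (mu : probability E R) (x : nat -> {RV P >-> E}) : Prop :=
  mutually_independent x /\
  forall n A, measurable A -> distribution P (x n) A = mu A.

(* The walk with increments x has drift gamma with respect to S. *)
Definition has_drift d (Omega : measurableType d) (G : groupType)
    (R : realType) (P : probability Omega R) (S : set G)
    (x : nat -> Omega -> G) (gamma : R) : Prop :=
  {ae P, forall w,
    ((word_length S (random_walk x n w))%:R / n%:R : R)%R
      @[n --> \oo] --> gamma}.

(* Main.v *)
Require Import Defs.
From mathcomp Require Import all_boot all_order all_algebra.
From mathcomp Require Import all_fingroup all_solvable.
From mathcomp Require Import all_classical all_reals all_analysis.
From mathcomp Require Import ring lra.

Import Order.TTheory GRing.Theory Num.Theory.
Import numFieldNormedType.Exports.

Local Open Scope classical_set_scope.
Local Open Scope ring_scope.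

(* The proof corrects the word length by a bounded function: one looks for
   f(g) = |g| + e(g) with e bounded and E[f(g x_1)] - f(g) = gamma for every g,
   the identity included. Then f(X_n) - n gamma is a martingale with bounded
   increments, hence f(X_n)/n, and with it |X_n|/n, tends to gamma almost surely.

   The correction is defined along normal forms by e(g l) = F_l e(g) + kappa_l,
   where F_l is the probability that the walk started at the letter l ever
   visits the identity: then the drift of f at g l does not depend on e(g), and
   what remains is a linear system for kappa and gamma. With r = mu(b), the
   number T = 1 - 2 r F_b is the larger root of
     (1+S) T^2 - 2 (S - S^2 + 2pq) T - (2 S^2 - 3pq - pqS) = 0,  S = p + q,
   whose reduced discriminant is (p^2+q^2+pq)(p^2+q^2-2pq+3). *)

(** * Right multiplication by a letter, and word length as the size of the normal form *)

Section NormalForms.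
Context {H K : groupType}.
Implicit Types (u v w : seq (H + K)) (l m : H + K).

Lemma fp_reduced_rcons u l : fp_reduced (rcons u l) =
  [&& fp_reduced u, fp_nontriv l & if u is m :: u' then fp_alt (last m u') l else true].
Proof.
rewrite /fp_reduced all_rcons; case: u => [|m u] /=; first by rewrite !andbT.
by rewrite rcons_path -!andbA; do !bool_congr.
Qed.

Lemma fp_mulw_cat u v : fp_reduced (u ++ v) -> fp_mulw u v = u ++ v.
Proof.
elim: u => //= l u IHu; rewrite fp_reduced_cons => /and3P[nl al /IHu ->].
by case: l nl al => h; case: (u ++ v) => [|[] h' w'] //= nh _;
  rewrite /fp_cons /= nh.
Qed.

(** This lemma and the next two cover the outcomes of right multiplication by a letter: the word
    grows, loses its last letter, or exchanges it for another one of the same factor. *)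
Lemma fp_mulw_extend u m l : fp_reduced (rcons u m) -> fp_nontriv l ->
  fp_alt m l -> fp_mulw (rcons u m) [:: l] = rcons (rcons u m) l.
Proof.
move=> ru nl al; rewrite fp_mulw_cat cats1 // fp_reduced_rcons ru nl /=.
by case: u ru => [|n u] //= _; rewrite last_rcons.
Qed.

Lemma fp_mulw_cancel u m l : fp_reduced (rcons u m) ->
  fp_lmul m [:: l] = [::] -> fp_mulw (rcons u m) [:: l] = u.
Proof.
rewrite fp_reduced_rcons => /andP[ru _] ml.
by rewrite /fp_mulw foldr_rcons ml; apply: fp_mulw1.
Qed.

Lemma fp_mulw_merge u m l n : fp_reduced (rcons u m) ->
  fp_lmul m [:: l] = [:: n] -> fp_nontriv n -> 
  (forall k, fp_alt k m = fp_alt k n) ->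
  fp_mulw (rcons u m) [:: l] = rcons u n.
Proof.
rewrite !fp_reduced_rcons => /and3P[ru _ am] ml nn mn.
rewrite /fp_mulw foldr_rcons ml -/(fp_mulw u [:: n]) fp_mulw_cat cats1 //.
rewrite fp_reduced_rcons ru nn /=.
by case: u am {ru} => [|k u] //=; rewrite mn.
Qed.

Lemma size_fp_lmul l w : (size (fp_lmul l w) <= (size w).+1)%N.
Proof.
by case: l w => h [|[] h' w] //=; rewrite /fp_cons; case: ifP => //= _;
  rewrite ltnW.
Qed.

Lemma size_fp_mulw u w : (size (fp_mulw u w) <= size u + size w)%N.
Proof.
by elim: u => //= l u IHu; apply: leq_trans (size_fp_lmul _ _) _; rewrite addSn ltnS.
Qed.

Lemma size_fp_letter (l : H + K) : (size (val (fp_letter l)) <= 1)%N.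
Proof. by rewrite /= /fp_cons; case: ifP. Qed.

Lemma size_fp_inv (g : free_product H K) :
  size (val (g^-1)%g) = size (val g).
Proof. by rewrite /= /fp_invw size_rev size_map. Qed.

Lemma val_mul_fp_letter (g : free_product H K) l : fp_nontriv l ->
  val (g * fp_letter l)%g = fp_mulw (val g) [:: l].
Proof. by move=> nl; rewrite /= /fp_cons nl. Qed.

(** The letters of the normal form give a product of [size (val g)] elements of [S]. No shorter one
    exists, because the size is subadditive and at most 1 on [S]. *)
Lemma word_length_fp (S : set (free_product H K)) :
  (forall l, fp_nontriv l -> S (fp_letter l)) ->
  (forall g, S g -> (size (val g) <= 1)%N) ->
  forall g, word_length S g = size (val g).
Proof.
move=> SL S1 g; have gE : exists s : seq (free_product H K),
    [/\ size s = size (val g), forall y, y \in s -> S y & (\prod_(y <- s) y)%g = g].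
  exists (map (@fp_letter H K) (val g)).
  rewrite size_map big_map -fp_prod_letters; split=> // y /mapP[l lg ->].
  by apply: SL; case/andP: (valP g) => /allP/(_ _ lg).
rewrite /word_length; case: pselect => [exP|[]]; last first.
  by exists (size (val g)); apply/asboolP.
case: ex_minnP => n /asboolP[s [<- sS sg]] nmin.
apply/eqP; rewrite eqn_leq nmin; last exact/asboolP.
rewrite -{}sg {nmin exP}; elim: s sS => [|h s IHs] sS; first by rewrite big_nil.
rewrite big_cons /=; apply: leq_trans (size_fp_mulw _ _) _.
apply: (@leq_add _ _ 1); first by apply/S1/sS/mem_head.
apply: IHs => y ys.
by apply: sS; rewrite in_cons ys orbT.
Qed.

End NormalForms.

Lemma Z3_generator (s : 'Z_3) : generator [set: 'Z_3]%SET s ->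
  [/\ s != 1%g, (s ^+ 2)%g != 1%g, (s ^+ 2)%g != s, (s ^+ 2 * s)%g = 1%g
    & forall h : 'Z_3, [\/ h = 1%g, h = s | h = (s ^+ 2)%g]].
Proof.
move=> hs.
have s1 : s != 1%g.
  apply: contraTneq hs => ->; rewrite /generator cycle1.
  by apply/eqP => /setP/(_ 1%R); rewrite !inE.
have s3 : (s ^+ 2 * s)%g = 1%g by case: s {hs} s1 => -[|[|[|]]] // i _; apply: val_inj.
split=> //.
- by apply: contraTneq s1 => e; rewrite -s3 e mul1g eqxx.
- apply: contraNneq s1; rewrite expgS expg1 => /(congr1 (mulg s^-1)%g).
  by rewrite mulKg mulVg => ->.
by move=> h; case: s s1 {hs s3} => -[|[|[|]]] // i _; case: h => -[|[|[|]]] // j;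
  [apply: Or31|apply: Or32|apply: Or33|apply: Or31|apply: Or33|apply: Or32];
  apply: val_inj.
Qed.

(** * Second moments along a walk with finitely supported increments *)

Section WordSums.
Context {G : groupType} {R : realType}.
Variables (L : seq G) (m : G -> R).

Fixpoint words (n : nat) : seq (seq G) :=
  if n is k.+1 then [seq rcons w l | w <- words k, l <- L] else [:: [::]].

(* The expectation of h(X_n) for increments of law m carried by L. *)
Definition wsum (n : nat) (h : G -> R) : R :=
  \sum_(w <- words n) (\prod_(l <- w) m l) * h (\prod_(l <- w) l)%g.

Lemma mkseq_words n (y : nat -> G) :
  (forall i, (i < n)%N -> y i \in L) -> mkseq y n \in words n.
Proof.
elim: n => [//|n IHn] yL /=; apply/allpairsP; exists (mkseq y n, y n).
by rewrite mkseqS /= IHn ?yL // => i /ltnW; apply: yL.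
Qed.

Lemma wsum0 h : wsum 0 h = h 1%g.
Proof. by rewrite /wsum big_seq1 !big_nil mul1r. Qed.

Lemma wsumS n h : wsum n.+1 h = wsum n (fun g => \sum_(l <- L) m l * h (g * l)%g).
Proof.
rewrite /wsum big_allpairs_dep; apply: eq_bigr => w _.
rewrite mulr_sumr; apply: eq_bigr => l _.
by rewrite -cats1 !big_cat !big_seq1 mulrA.
Qed.

Hypothesis m0 : forall l, 0 <= m l.
Hypothesis m1 : \sum_(l <- L) m l = 1.

Lemma le_wsum n h h' : (forall g, h g <= h' g) -> wsum n h <= wsum n h'.
Proof.
by move=> hh'; apply: ler_sum => w _; rewrite ler_wpM2l ?hh' ?prodr_ge0.
Qed.

Lemma wsum_addr n h c : wsum n (fun g => h g + c) = wsum n h + c.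
Proof.
elim: n h => [|n IHn] h; first by rewrite !wsum0.
rewrite !wsumS -IHn; congr wsum; apply/funext => g.
under eq_bigr => l _ do rewrite mulrDr.
by rewrite big_split /= -mulr_suml m1 mul1r.
Qed.

(** For centred [D] the cross term [2 * M * D] averages to zero; this is the orthogonality of
    martingale increments. *)
Lemma variance_split (M : R) (D : G -> R) : \sum_(l <- L) m l * D l = 0 ->
  \sum_(l <- L) m l * (M + D l) ^+ 2 = M ^+ 2 + \sum_(l <- L) m l * D l ^+ 2.
Proof.
move=> mD; transitivity (\sum_(l <- L) (m l * M ^+ 2 + (2 * M * (m l * D l) +
  m l * D l ^+ 2))); first by apply: eq_bigr => l _; ring.
by rewrite !big_split /= -mulr_suml -mulr_sumr m1 mD mul1r mulr0 add0r.
Qed.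

(** Given the past, the centred increment of [f] has mean zero and size at most [K], so by
    [variance_split] each step adds at most [K ^+ 2] to the second moment. *)
Lemma wsum_sqr_le (f : G -> R) (v K : R) :
  (forall g, \sum_(l <- L) m l * (f (g * l)%g - f g) = v) ->
  (forall g l, l \in L -> `|f (g * l)%g - f g - v| <= K) ->
  forall n, wsum n (fun g => (f g - f 1%g - n%:R * v) ^+ 2) <= n%:R * K ^+ 2.
Proof.
move=> fv fK; elim=> [|n IHn].
  by rewrite wsum0 !mul0r subrr subr0 expr0n.
rewrite wsumS; apply: le_trans (_ : _ <= n%:R * K ^+ 2 + K ^+ 2) _; last first.
  by rewrite -natr1 mulrDl mul1r.
apply: le_trans (lerD IHn (lexx _)); rewrite -wsum_addr; apply: le_wsum => g.
set M := f g - f 1%g - n%:R * v.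
have -> : \sum_(l <- L) m l * (f (g * l)%g - f 1%g - n.+1%:R * v) ^+ 2 =
  \sum_(l <- L) m l * (M + (f (g * l)%g - f g - v)) ^+ 2.
  by apply: eq_bigr => l _; rewrite /M -natr1; congr (_ * _ ^+ 2); ring.
rewrite variance_split; last first.
  under eq_bigr => l _ do rewrite mulrBr.
  by rewrite sumrB fv -mulr_suml m1 mul1r subrr.
rewrite lerD2l -[leRHS]mul1r -m1 mulr_suml big_seq [leRHS]big_seq.
apply: ler_sum => l lL; rewrite ler_wpM2l // -real_normK ?num_real //.
by rewrite lerXn2r ?nnegrE ?fK // (le_trans _ (fK 1%g l lL)).
Qed.

Lemma wsum_markov n (h : G -> R) c : 0 < c -> (forall g, 0 <= h g) ->
  \sum_(w <- words n | c <= h (\prod_(l <- w) l)%g) \prod_(l <- w) m l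
    <= wsum n h / c.
Proof.
move=> c0 h0; rewrite ler_pdivlMr // mulr_suml big_mkcond /=.
apply: ler_sum => w _; case: ifP => ch; last by rewrite mulr_ge0 ?prodr_ge0.
by rewrite ler_wpM2l ?prodr_ge0.
Qed.

End WordSums.

(** * Sublinear growth deduced from fourth powers *)

Lemma fourth_power_bracket n : exists m, (m ^ 4 <= n < m.+1 ^ 4)%N.
Proof.
elim: n => [|n [m /andP[mn nm]]]; first by exists 0%N.
have [nm'|nm'] := ltnP n.+1 (m.+1 ^ 4); first by exists m; rewrite leqW.
exists m.+1; rewrite nm' /=; apply: leq_ltn_trans nm _.
by rewrite ltn_exp2r.
Qed.

Lemma cvg_div_nat_bounded {R : realType} (u : nat -> R) (C : R) :
  (forall n, `|u n| <= C) -> u n / n%:R @[n --> \oo] --> (0 : R).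
Proof.
move=> uC; have C0 : 0 <= C by apply: le_trans (uC 0%N).
apply/cvgrPdist_le => e e0; near=> n.
have n0 : (0 : R) < n%:R by near: n; exists 1%N => //= k k1; rewrite ltr0n.
rewrite sub0r normrN normf_div [`|n%:R|]gtr0_norm // ler_pdivrMr //.
apply: le_trans (uC n) _; rewrite -ler_pdivrMl //.
by near: n; exact: nbhs_infty_ger.
Unshelve. all: by end_near. Qed.

(** For m >= 1, consecutive fourth powers differ by at most 15 m^3. Bounded increments thus give |u
    n| <= (1 + 15 K) m^3 on the whole block m^4 <= n < (m+1)^4, which is negligible against n. *)
Lemma cvg_div_nat_fourth_powers {R : realType} (u : nat -> R) (K : R) (N : nat) :
  (forall n, `|u n.+1 - u n| <= K) ->
  (forall m, (N <= m)%N -> `|u (m ^ 4)%N| <= m%:R ^+ 3) ->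
  u n / n%:R @[n --> \oo] --> (0 : R).
Proof.
move=> uK uN; have K0 : 0 <= K by apply: le_trans (uK 0%N).
have uD k j : `|u (k + j)%N - u k| <= K * j%:R.
  elim: j => [|j IHj]; first by rewrite addn0 subrr normr0 mulr0.
  rewrite addnS -natr1 mulrDr mulr1 [leRHS]addrC.
  by rewrite -(subrKA (u (k + j)%N)) (le_trans (ler_normD _ _)) // lerD.
apply/cvgrPdist_le => e e0.
have K1 : 0 <= (1 + 15 * K) / e.
  by apply: divr_ge0; [apply: addr_ge0 => //; apply: mulr_ge0 | apply: ltW].
pose M := Num.bound ((1 + 15 * K) / e).
have hM : (1 + 15 * K) / e <= M%:R by apply/ltW/archi_boundP.
pose m0 := maxn 1 (maxn N M).
exists (m0 ^ 4)%N => //= n m0n.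
have [m /andP[mn nm]] := fourth_power_bracket n.
have m0m : (m0 <= m)%N by rewrite -ltnS -(@ltn_exp2r _ _ 4) // (leq_ltn_trans m0n).
have /and3P[m1 Nm Mm] : [&& 1 <= m, N <= m & M <= m]%N by rewrite -!geq_max.
have n0 : (0 : R) < n%:R.
  by rewrite ltr0n (leq_trans _ mn) // expn_gt0 m1.
have m1R : (1 : R) <= m%:R by rewrite ler1n.
rewrite sub0r normrN normf_div [`|n%:R|]gtr0_norm // ler_pdivrMr //.
have un : `|u n| <= (1 + 15 * K) * m%:R ^+ 3.
  rewrite -(subrK (u (m ^ 4)%N) (u n)) (le_trans (ler_normD _ _)) //.
  rewrite mulrDl mul1r addrC lerD ?uN // -(subnKC mn) (le_trans (uD _ _)) //.
  rewrite mulrAC [leRHS]mulrC ler_wpM2l //.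
  have : ((n - m ^ 4)%N)%:R <= (m.+1 ^ 4 - m ^ 4)%N%:R :> R.
    by rewrite ler_nat leq_sub2r // ltnW.
  move=> /le_trans; apply.
  rewrite natrB ?leq_exp2r // !natrX -natr1.
  have -> : (m%:R + 1 : R) ^+ 4 - m%:R ^+ 4 =
    4 * m%:R ^+ 3 + 6 * m%:R ^+ 2 + 4 * m%:R + 1 by ring.
  have h2 : (m%:R : R) ^+ 2 <= m%:R ^+ 3 by rewrite ler_weXn2l.
  have h1 : (m%:R : R) <= m%:R ^+ 3 by rewrite -[leLHS]expr1 ler_weXn2l.
  have h0 : (1 : R) <= m%:R ^+ 3 by rewrite exprn_ege1.
  lra.
apply: le_trans un _.
have : e * m%:R ^+ 4 <= e * n%:R by rewrite ler_wpM2l ?(ltW e0) // -natrX ler_nat.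
apply: le_trans; rewrite [m%:R ^+ 4]exprS mulrA ler_wpM2r ?exprn_ge0 //.
by rewrite -ler_pdivrMl // [leLHS]mulrC (le_trans hM) // ler_nat.
Qed.

(** * Law of large numbers for functions of constant drift *)

Section RandomWalk.
Context {H K : groupType} {R : realType} {d : measure_display}
  {Omega : measurableType d} {P : probability Omega R}.
Local Notation G := (free_product H K).
Variables (mu : probability G R) (x : nat -> {RV P >-> G}).
Hypothesis hx : iid_of_law mu x.
Variable L : seq G.
Hypothesis uL : uniq L.

Let m (g : G) : R := fine (mu [set g]).

Let muE g : mu [set g] = (m g)%:E.
Proof. by rewrite /m fineK // fin_num_measure. Qed.

Let m0 g : 0 <= m g.
Proof. by rewrite -lee_fin -muE. Qed.

Hypothesis m1 : \sum_(l <- L) m l = 1.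

Lemma measurable_increment n (A : set G) : measurable (x n @^-1` A).
Proof. by rewrite -[_ @^-1` _]setTI; apply: measurable_funP. Qed.

Lemma probability_increment_notin n : P (x n @^-1` (~` [set` L])) = 0%E.
Proof.
have [_ /(_ n (~` [set` L]) I)] := hx; rewrite /distribution /pushforward => ->.
rewrite probability_setC //.
suff -> : mu [set` L] = 1%E by rewrite subee.
have muL (s : seq G) : uniq s -> mu [set` s] = (\sum_(l <- s) m l)%:E.
  elim: s => [_|l s IHs /= /andP[ls us]].
    by rewrite big_nil (_ : [set` _] = set0) ?measure0 // -subset0 => y.
  rewrite big_cons EFinD -IHs // -muE -measureU //.
    by congr (mu _); apply/seteqP; split=> y /=; rewrite inE => /predU1P.
  by rewrite -subset0 => y [/= -> ls']; rewrite ls' in ls.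
by rewrite muL // m1.
Qed.

(** The index set is a list from [iota], the form in which [mutually_independent] computes
    probabilities. *)
Definition cylinder (w : seq G) : set Omega :=
  \bigcap_(j in [set` iota 0 (size w)]) (x j @^-1` [set nth 1%g w j]).

Lemma measurable_cylinder w : measurable (cylinder w).
Proof.
rewrite /cylinder; apply: fin_bigcap_measurable => [|j _]; first exact: finite_seq.
exact: measurable_increment.
Qed.

Lemma probability_cylinder w : P (cylinder w) = (\prod_(l <- w) m l)%:E.
Proof.
have [ind law] := hx.
rewrite /cylinder (ind _ (fun j => [set nth 1%g w j])) ?iota_uniq //.
rewrite (big_nth 1%g) -prodEFin /index_iota subn0.
by apply: eq_bigr => j _; rewrite -muE; apply: law.
Qed.

Lemma random_walk_cylinder w omega : cylinder w omega ->
  random_walk x (size w) omega = (\prod_(l <- w) l)%g.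
Proof.
have : forall n, (n <= size w)%N -> cylinder w omega ->
    random_walk x n omega = (\prod_(l <- take n w) l)%g.
  elim=> [|n IHn] nw cw; first by rewrite take0 big_nil.
  rewrite (take_nth 1%g nw) -cats1 big_cat big_seq1 /= IHn // ?(ltnW nw) //.
  by congr (_ * _)%g; apply: cw; rewrite /= mem_iota.
by move=> /(_ _ (leqnn _)) h /h ->; rewrite take_size.
Qed.

Lemma cylinder_mkseq n omega : cylinder (mkseq (fun i => x i omega) n) omega.
Proof.
by move=> j /=; rewrite size_mkseq mem_iota add0n => jn; rewrite nth_mkseq.
Qed.

Lemma probability_cylinders_le (s : seq (seq G)) (Q : pred (seq G)) :
  (P (\big[setU/set0]_(w <- s | Q w) cylinder w) <=
   (\sum_(w <- s | Q w) \prod_(l <- w) m l)%:E)%E.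
Proof.
elim: s => [|w s IHs]; first by rewrite !big_nil measure0.
rewrite !big_cons; case: ifP => // _.
rewrite EFinD -probability_cylinder; apply: le_trans (leeD2l _ IHs).
apply: measureU2; first exact: measurable_cylinder.
by apply: bigsetU_measurable => *; apply: measurable_cylinder.
Qed.

Lemma random_walk_lln (f : G -> R) (v C : R) :
  (forall g, \sum_(l <- L) m l * (f (g * l)%g - f g) = v) ->
  (forall g l, l \in L -> `|f (g * l)%g - f g| <= C) ->
  {ae P, forall omega, f (random_walk x n omega) / n%:R @[n --> \oo] --> v}.
Proof.
(* Chebyshev at the times n = k^4 with threshold k^3 gives probabilities of
   order k^-2, and the walk moves by O(k^3) between consecutive such times. *)
move=> fv fC; pose K0 := C + `|v|.
have fK g l : l \in L -> `|f (g * l)%g - f g - v| <= K0.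
  by move=> lL; rewrite (le_trans (ler_normB _ _)) // lerD2r fC.
pose M n g := f g - f 1%g - n%:R * v.
(* [B k] is the event that [M] is at least (k+1)^3 in absolute value at time (k+1)^4, for increments
   in [L]; as a finite union of cylinders it is measurable. The shift by one excludes time 0. *)
pose B k := \big[setU/set0]_(w <- words L (k.+1 ^ 4) |
  k.+1%:R ^+ 6 <= M (k.+1 ^ 4)%N (\prod_(l <- w) l)%g ^+ 2) cylinder w.
have mB k : measurable (B k).
  by apply: bigsetU_measurable => *; apply: measurable_cylinder.
have PB k : (P (B k) <= (K0 ^+ 2 / k.+1%:R ^+ 2)%:E)%E.
  apply: le_trans (probability_cylinders_le _ _) _; rewrite lee_fin.
  apply: le_trans (wsum_markov _ _ m0 _ (fun g => M (k.+1 ^ 4)%N g ^+ 2) _ _ _) _.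
  - by rewrite exprn_gt0.
  - by move=> g; apply: sqr_ge0.
  rewrite ler_pdivrMr ?exprn_gt0 //.
  apply: le_trans (wsum_sqr_le _ _ m0 m1 _ _ _ fv fK _) _.
  rewrite natrX le_eqVlt; apply/orP; left; apply/eqP.
  have : k.+1%:R != 0 :> R by rewrite pnatr_eq0.
  by move: (k.+1%:R : R) => X X0; field.
have limB : P (lim_sup_set B) = 0%E.
  apply: lim_sup_set_cvg0 => //.
  apply: (@le_lt_trans _ _ (2 * K0 ^+ 2)%:E); last exact: ltry.
  apply: lime_le; first by apply: is_cvg_nneseries.
  apply: nearW => n.
  (* Telescoping majorant: 2 (1/(n+1) - 1/(n+2)) dominates 1/(n+1)^2. *)
  apply: (@le_trans _ _ (2 * K0 ^+ 2 * (1 - n.+1%:R^-1))%:E); last first.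
    by rewrite lee_fin ler_piMr ?gerBl ?invr_ge0 // (mulr_ge0 _ (sqr_ge0 _)).
  elim: n => [|n IHn]; first by rewrite big_geq // invr1 subrr mulr0.
  rewrite big_nat_recr //=; apply: le_trans (leeD IHn (PB n)) _.
  rewrite -EFinD lee_fin -subr_ge0 -[n.+2%:R]natr1.
  have : (1 : R) <= n.+1%:R by rewrite ler1n.
  move: (n.+1%:R : R) => X X1; have X0 : 0 < X by apply: lt_le_trans X1.
  have -> : 2 * K0 ^+ 2 * (1 - (X + 1)^-1) -
      (2 * K0 ^+ 2 * (1 - X^-1) + K0 ^+ 2 / X ^+ 2) =
      K0 ^+ 2 * (X - 1) / (X ^+ 2 * (X + 1)).
    by field; rewrite !gt_eqF // addr_gt0.
  apply: divr_ge0; apply: mulr_ge0; rewrite ?sqr_ge0 ?subr_ge0 //.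
  by rewrite addr_ge0 // ltW.
have nullN : P.-negligible (\bigcup_n (x n @^-1` (~` [set` L]))).
  apply: negligible_bigcup => n; exists (x n @^-1` (~` [set` L])); split=> //.
    exact: measurable_increment.
  exact: probability_increment_notin.
have nullB : P.-negligible (lim_sup_set B).
  by exists (lim_sup_set B); split=> //; apply: bigcapT_measurable => n;
    apply: bigcup_measurable.
apply: negligibleS (negligibleU nullN nullB) => omega /=.
apply: contra_notP => /not_orP[NN NB].
have xL n : x n omega \in L.
  by apply: contra_notT NN => xnL; exists n => //=; apply/negP.
have [N hN] : exists N, forall k, (N <= k)%N -> ~ B k omega.
  apply: contra_notP NB => /forallNP h n _.
  have /existsNP[k /not_implyP[nk /contrapT Bk]] := h n.
  by exists k.
pose u n := M n (random_walk x n omega).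
have uC n : `|u n.+1 - u n| <= K0.
  rewrite /u /M /= -natr1.
  set X := random_walk _ _ _.
  have -> : f (X * x n omega)%g - f 1%g - (n%:R + 1) * v - (f X - f 1%g - n%:R * v)
    = f (X * x n omega)%g - f X - v by ring.
  exact: fK.
(* [B k] concerns time (k+1)^4, hence the threshold [N.+1]. A larger value would place the path in
   the cylinder of its own increments, one of those that form [B k]. *)
have uN k : (N.+1 <= k)%N -> `|u (k ^ 4)%N| <= k%:R ^+ 3.
  case: k => // k Nk; rewrite -(@ler_pXn2r _ 2) ?nnegrE ?exprn_ge0 //.
  rewrite real_normK ?num_real // -exprM leNgt; apply/negP => Mk.
  apply: (hN k Nk); pose w := mkseq (fun i => x i omega) (k.+1 ^ 4).
  have sw : size w = (k.+1 ^ 4)%N by rewrite size_mkseq.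
  have cw : cylinder w omega by apply: cylinder_mkseq.
  rewrite /B big_seq_cond -bigcup_seq_cond; exists w => //=.
  by rewrite mkseq_words //= -(random_walk_cylinder _ _ cw) sw ltW.
have u0 := cvg_div_nat_fourth_powers _ _ _ uC uN.
have f0 := cvg_div_nat_bounded (fun=> f 1%g) `|f 1%g| (fun=> lexx _).
have uv : u n / n%:R + f 1%g / n%:R + v @[n --> \oo] --> v.
  by rewrite -[X in _ --> X]add0r -[X in _ --> X + _]add0r; apply: cvgD (cvg_cst v);
    apply: cvgD u0 f0.
apply: cvg_trans uv; apply: near_eq_cvg; exists 1%N => // n /= n0.
have n0R : n%:R != 0 :> R by rewrite pnatr_eq0 -lt0n.
by rewrite /u /M; field.
Qed.

End RandomWalk.

(** * The algebraic equations for the drift and the correction *)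

Lemma spectral_root (R : rcfType) (p q : R) :
  0 <= p -> 0 <= q -> 0 < p + q -> p + q < 1 ->
  let u := Num.sqrt ((p ^+ 2 + q ^+ 2 + p * q) /
                     (p ^+ 2 + q ^+ 2 - 2 * p * q + 3)) in
  let T := (p + q - (p + q) ^+ 2 + 2 * (p * q) +
            (p ^+ 2 + q ^+ 2 - 2 * p * q + 3) * u) / (1 + (p + q)) in
  [/\ (p ^+ 2 + q ^+ 2 - 2 * p * q + 3) * u ^+ 2 = p ^+ 2 + q ^+ 2 + p * q,
      p + q < T & T < 1].
Proof.
move=> p0 q0 pq0 pq1.
set A := p ^+ 2 + q ^+ 2 + p * q.
set B := p ^+ 2 + q ^+ 2 - 2 * p * q + 3.
(* [B * u] is the square root of [A * B], so [T] is the larger root of the quadratic. Its bounds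
   will put [z = (1 - T) / (1 - p - q)] strictly between 0 and 1. *)
move=> u T.
have A0 : 0 < A.
  have : 0 < (p + q) ^+ 2 by rewrite exprn_gt0.
  have : 0 <= p ^+ 2 by rewrite sqr_ge0.
  have : 0 <= q ^+ 2 by rewrite sqr_ge0.
  by rewrite /A; nra.
have B0 : 0 < B by rewrite /B; nra.
have u0 : 0 < u by rewrite sqrtr_gt0 divr_gt0.
have uE : B * u ^+ 2 = A.
  by rewrite sqr_sqrtr ?divr_ge0 1?ltW // mulrC divfK ?gt_eqF.
have s0 : 0 < 1 + (p + q) by lra.
split=> //.
- rewrite ltr_pdivlMr //.
  have u2 : 2 * u < 1.
    rewrite -(@ltr_pXn2r _ 2) ?nnegrE ?ler01 ?mulr_ge0 ?(ltW u0) //.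
    rewrite expr1n exprMn -(ltr_pM2l B0) mulrCA uE /A /B.
    by nra.
  have : B * u * (2 * u) < B * u * 1 by rewrite ltr_pM2l // mulr_gt0.
  have -> : B * u * (2 * u) = 2 * A by rewrite -uE; ring.
  by rewrite /A; lra.
- rewrite ltr_pdivrMr // mul1r.
  have h0 : 0 <= 1 + (p + q) ^+ 2 - 2 * (p * q) by nra.
  suff : B * u < 1 + (p + q) ^+ 2 - 2 * (p * q) by lra.
  rewrite -(@ltr_pXn2r _ 2) ?nnegrE ?mulr_ge0 ?(ltW u0) ?(ltW B0) //.
  have -> : (B * u) ^+ 2 = A * B by rewrite -uE; ring.
  rewrite -subr_gt0.
  have -> : (1 + (p + q) ^+ 2 - 2 * (p * q)) ^+ 2 - A * B =
     (1 + (p + q)) * ((1 - (p + q)) * (1 - p * q)) by rewrite /A /B; ring.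
  by rewrite !mulr_gt0 ?subr_gt0 //; nra.
Qed.

(* x, y, z are the first-passage probabilities F_a, F_(a^2), F_b = F_(b^2), and
   k, k' the constants kappa_a, kappa_(a^2). Adding a constant to e allows the
   normalisation kappa_b = 0; the constant e is then e(1). The four equations
   are the drift equations after a, after a^2, after b or b^2, and at 1, where c
   is the value of the correction before the last letter. *)
Lemma potential_coefficients (R : rcfType) (p q : R) :
  0 <= p -> 0 <= q -> 0 < p + q -> p + q < 1 ->
  let r := (1 - p - q) / 2 in
  let v := 2 * (1 - p - q) *
           Num.sqrt ((p ^+ 2 + q ^+ 2 + p * q) /
                     (p ^+ 2 + q ^+ 2 - 2 * p * q + 3)) in
  exists x y z k k' e : R,
  [/\ 0 <= x < 1, 0 <= y < 1 & 0 <= z < 1] /\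
  [/\ forall c, p * (y * c + k' - (x * c + k)) + q * (c - (x * c + k) - 1) +
        2 * r * (z * (x * c + k) - (x * c + k) + 1) = v,
      forall c, p * (c - (y * c + k') - 1) + q * (x * c + k - (y * c + k')) +
        2 * r * (z * (y * c + k') - (y * c + k') + 1) = v,
      forall c, p * (x * (z * c) + k - z * c + 1) +
        q * (y * (z * c) + k' - z * c + 1) + r * (c - z * c - 1) = v
    & p * (x * e + k - e + 1) + q * (y * e + k' - e + 1) +
        2 * r * (z * e - e + 1) = v].
Proof.
move=> p0 q0 pq0 pq1 r v.
have [] := @spectral_root R p q p0 q0 pq0 pq1.
rewrite -/v; move: @v.
set B := p ^+ 2 + q ^+ 2 - 2 * p * q + 3.
set A := p ^+ 2 + q ^+ 2 + p * q.
move: (Num.sqrt _) => u v uE.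
set T := (_ / _) => sT T1.
have s0 : 0 < 1 + (p + q) by lra.
have s1 : 0 < 1 - p - q by lra.
have T0 : 0 < T by lra.
have D0 : 0 < T ^+ 2 - p * q by nra.
have D0' : T ^+ 2 - p * q != 0 by rewrite gt_eqF.
have BuE : B * u = (1 + (p + q)) * T - (p + q - (p + q) ^+ 2 + 2 * (p * q)).
  by rewrite /T mulrC [X in _ = X - _]mulrC divfK ?gt_eqF // addrC addKr mulrC.
have TQ : (1 + (p + q)) * T ^+ 2 -
   2 * (p + q - (p + q) ^+ 2 + 2 * (p * q)) * T -
   (2 * (p + q) ^+ 2 - 3 * (p * q) - p * q * (p + q)) = 0.
  apply: (mulfI (lt0r_neq0 s0)); rewrite mulr0.
  transitivity ((B * u) ^+ 2 - B * A); last by rewrite -uE; ring.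
  by rewrite BuE /A /B; ring.
(* The drift equations after [a] and [a^2] are affine in [c]. Their linear coefficients give [hx],
   [hy], their constant terms [hk], [hk']: two systems of determinant [T ^+ 2 - p * q], solved by
   Cramer's rule. The value of [z] makes [T = 1 - 2 * r * z]. *)
pose x := (q * T + p ^+ 2) / (T ^+ 2 - p * q).
pose y := (p * T + q ^+ 2) / (T ^+ 2 - p * q).
pose z := (1 - T) / (1 - p - q).
pose k := (T * (2 * r - q - v) + p * (2 * r - p - v)) / (T ^+ 2 - p * q).
pose k' := (T * (2 * r - p - v) + q * (2 * r - q - v)) / (T ^+ 2 - p * q).
have z0 : 0 < z by rewrite divr_gt0 // subr_gt0.
have z1 : z < 1 by rewrite /z ltr_pdivrMr //; lra.
have x0 : 0 <= x by rewrite divr_ge0 ?(ltW D0) //; nra.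
have y0 : 0 <= y by rewrite divr_ge0 ?(ltW D0) //; nra.
have x1 : x < 1 by rewrite /x ltr_pdivrMr //; nra.
have y1 : y < 1 by rewrite /y ltr_pdivrMr //; nra.
have r0 : 0 < r by rewrite /r; lra.
have TE : T = 1 - 2 * r * z by rewrite /r /z; field; rewrite gt_eqF.
have hx : T * x = p * y + q by rewrite /x /y; field.
have hy : T * y = q * x + p by rewrite /x /y; field.
have hk : T * k - p * k' = 2 * r - q - v by rewrite /k /k'; field.
have hk' : T * k' - q * k = 2 * r - p - v by rewrite /k /k'; field.
(* This is the coefficient of [c] in the equation after [b]; times [T ^+ 2 - p * q] it is a multiple
   of the quadratic in [TQ]. The constant term of that equation is [hkk], which determines [v]. *)
have hz : z * (1 - r - p * x - q * y) = r.
  apply: subr0_eq; apply: (mulIf D0'); rewrite mul0r.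
  transitivity ((T - (p + q)) / (2 * (1 - p - q)) * - ((1 + (p + q)) * T ^+ 2 -
   2 * (p + q - (p + q) ^+ 2 + 2 * (p * q)) * T -
   (2 * (p + q) ^+ 2 - 3 * (p * q) - p * q * (p + q)))).
    by rewrite /x /y /z /r; field; rewrite D0' gt_eqF.
  by rewrite TQ oppr0 mulr0.
(* The cofactor of B u^2 - A is the quotient of a division of polynomials in u. *)
have hkk : p * k + q * k' = v + r - (p + q).
  apply: subr0_eq; apply: (mulIf D0'); rewrite mul0r.
  transitivity (((- 2 * (p + q) * (1 - (p + q) ^+ 2) - (1 - 3 * (p + q)) * B / 2
     - 4 * (1 - (p + q)) * (p + q - (p + q) ^+ 2 + 2 * (p * q)))
     - 2 * (1 - (p + q)) * B * u) / (1 + (p + q)) ^+ 2 * (B * u ^+ 2 - A)).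
    transitivity (p * (k * (T ^+ 2 - p * q)) + q * (k' * (T ^+ 2 - p * q)) -
      (v + r - (p + q)) * (T ^+ 2 - p * q)); first by ring.
    rewrite !divfK // /v /r /T /B /A; field; exact: lt0r_neq0.
  by rewrite uE subrr mulr0.
(* In terms of first-passage probabilities, [w] is the chance of never returning to 1. As
   [p + q + 2 * r = 1], the equation at 1 reads [w * e = 3 * r] by [hkk]. *)
pose w := p * (1 - x) + q * (1 - y) + 2 * r * (1 - z).
have w0 : 0 < w.
  have rz0 : 0 < 2 * r * (1 - z).
    by apply: mulr_gt0; [apply: mulr_gt0 r0 | rewrite subr_gt0].
  have px0 : 0 <= p * (1 - x) by rewrite mulr_ge0 // subr_ge0 ltW.
  have qy0 : 0 <= q * (1 - y) by rewrite mulr_ge0 // subr_ge0 ltW.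
  by apply: ltr_wpDl rz0; apply: addr_ge0.
have hw : 3 * r / w * w = 3 * r by rewrite divfK // gt_eqF.
exists x, y, z, k, k', (3 * r / w).
split; first by rewrite x0 y0 x1 y1 z1 ltW.
split.
- move=> c; transitivity (c * (p * y + q - T * x) + (2 * r - q) - (T * k - p * k')).
    by rewrite TE /r; field.
  by rewrite hx hk; ring.
- move=> c; transitivity (c * (q * x + p - T * y) + (2 * r - p) - (T * k' - q * k)).
    by rewrite TE /r; field.
  by rewrite hy hk'; ring.
- move=> c; transitivity (c * (r - z * (1 - r - p * x - q * y)) +
      (p * k + q * k') - r + (p + q)).
    by rewrite /r; field.
  by rewrite hz hkk; ring.
- transitivity (1 + (p * k + q * k') - (3 * r / w * w)).
    by move: (3 * r / w) => e; rewrite /w /r; field.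
  by rewrite hkk hw /r; field.
Qed.

(** * The corrected length on normal forms *)

Section Potential.
Context {R : realType}.
Variables (s t : 'Z_3) (x y z k k' e : R).
Hypotheses (hs : generator [set: 'Z_3]%SET s) (ht : generator [set: 'Z_3]%SET t).

(** Letters of the second factor share the value [z], as [b] and [b^2] have equal mass. The [else]
    branch also covers the trivial element, which no normal form contains. *)
Let F (l : 'Z_3 + 'Z_3) : R :=
  match l with inl h => if h == s then x else y | inr _ => z end.
Let kappa (l : 'Z_3 + 'Z_3) : R :=
  match l with inl h => if h == s then k else k' | inr _ => 0 end.

Definition correction (w : seq ('Z_3 + 'Z_3)) : R :=
  foldl (fun c l => F l * c + kappa l) e w.

Definition potential (w : seq ('Z_3 + 'Z_3)) : R := (size w)%:R + correction w.

(** Every letter acts on the correction by an affine map of ratio at most [rho < 1], so the interval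
    of radius [C] around 0 is stable. *)
Lemma correction_bounded : 0 <= x < 1 -> 0 <= y < 1 -> 0 <= z < 1 ->
  exists C, forall w, `|correction w| <= C.
Proof.
move=> /andP[x0 x1] /andP[y0 y1] /andP[z0 z1].
pose rho := Num.max x (Num.max y z).
have rho1 : rho < 1 by rewrite !gt_max x1 y1 z1.
have Frho l : 0 <= F l <= rho.
  by case: l => h; rewrite /F /rho; last (by rewrite z0 !le_max lexx !orbT);
    case: ifP; rewrite ?x0 ?y0 !le_max lexx ?orbT.
have kk l : `|kappa l| <= `|k| + `|k'|.
  case: l => h; rewrite /kappa ?normr0 ?addr_ge0 //.
  by case: ifP; rewrite ?lerDl ?lerDr.
pose C := `|e| + (`|k| + `|k'|) / (1 - rho).
have eC : `|e| <= C by rewrite lerDl divr_ge0 ?subr_ge0 ?(ltW rho1) ?addr_ge0.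
have C0 : 0 <= C by apply: le_trans eC.
exists C; apply: last_ind => [//|w l IHw].
rewrite /correction foldl_rcons -/(correction w).
apply: le_trans (ler_normD _ _) _; rewrite normrM.
have /andP[F0 Fr] := Frho l; rewrite ger0_norm //.
apply: le_trans (lerD (ler_pM F0 (normr_ge0 _) Fr IHw) (kk l)) _.
rewrite -subr_ge0 /C; have -> : `|e| + (`|k| + `|k'|) / (1 - rho) -
  (rho * (`|e| + (`|k| + `|k'|) / (1 - rho)) + (`|k| + `|k'|)) = (1 - rho) * `|e|.
  by field; rewrite subr_eq0 gt_eqF.
by rewrite mulr_ge0 // subr_ge0 ltW.
Qed.

Lemma potential_rcons w l : potential (rcons w l) =
  (size w)%:R + 1 + (F l * correction w + kappa l).
Proof. by rewrite /potential size_rcons -natr1 /correction foldl_rcons. Qed.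

(** Of the four steps one cancels the last letter, one turns it into the other letter of its factor,
    and two prolong the word. So the drift equation of that letter applies, with [c] the correction
    of the word before it. *)
Lemma potential_drift (p q r v : R) :
  (forall c, p * (y * c + k' - (x * c + k)) + q * (c - (x * c + k) - 1) +
     2 * r * (z * (x * c + k) - (x * c + k) + 1) = v) ->
  (forall c, p * (c - (y * c + k') - 1) + q * (x * c + k - (y * c + k')) +
     2 * r * (z * (y * c + k') - (y * c + k') + 1) = v) ->
  (forall c, p * (x * (z * c) + k - z * c + 1) +
     q * (y * (z * c) + k' - z * c + 1) + r * (c - z * c - 1) = v) ->
  p * (x * e + k - e + 1) + q * (y * e + k' - e + 1) +
     2 * r * (z * e - e + 1) = v ->
  forall w, fp_reduced w ->
  p * (potential (fp_mulw w [:: inl s]) - potential w) +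
  q * (potential (fp_mulw w [:: inl (s ^+ 2)%g]) - potential w) +
  r * (potential (fp_mulw w [:: inr t]) - potential w) +
  r * (potential (fp_mulw w [:: inr (t ^+ 2)%g]) - potential w) = v.
Proof.
move=> va va2 vb v1.
have [s1 s21 s2s s3 sP] := Z3_generator s hs.
have [t1 t21 t2t t3 tP] := Z3_generator t ht.
have cube (h : 'Z_3) : (h ^+ 2 * h)%g = 1%g ->
    (h * h ^+ 2)%g = 1%g /\ (h ^+ 2 * h ^+ 2)%g = h.
  move=> h3; split; first by rewrite -expgS expgSr.
  by rewrite {2}expgS expg1 mulgA h3 mul1g.
have [s3' s4] := cube s s3; have [t3' t4] := cube t t3.
have sE : (s ^+ 2 == s)%g = false by apply/negbTE.
case/lastP => [_|w m rm].
  rewrite /= /potential /correction /= eqxx sE -v1; ring.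
have Sw := potential_rcons w.
have ext l : fp_nontriv l -> fp_alt m l ->
  potential (fp_mulw (rcons w m) [:: l]) = (size w)%:R + 2 +
    (F l * (F m * correction w + kappa m) + kappa l).
  move=> nl ml; rewrite fp_mulw_extend // potential_rcons size_rcons -natr1.
  by rewrite /correction foldl_rcons; ring.
have can l : fp_lmul m [:: l] = [::] ->
  potential (fp_mulw (rcons w m) [:: l]) = (size w)%:R + correction w.
  by move=> ml; rewrite fp_mulw_cancel.
have mer l n : fp_lmul m [:: l] = [:: n] -> fp_nontriv n ->
  (forall k, fp_alt k m = fp_alt k n) ->
  potential (fp_mulw (rcons w m) [:: l]) = (size w)%:R + 1 +
    (F n * correction w + kappa n).
  by move=> ml nn mn; rewrite (fp_mulw_merge _ _ _ n) // potential_rcons.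
have nm : fp_nontriv m by move: rm; rewrite fp_reduced_rcons => /and3P[].
have sq (h : 'Z_3) : (h * h)%g = (h ^+ 2)%g by rewrite expgS expg1.
case: m rm ext can mer nm => h rm ext can mer nm.
- have [h1|hE|hE] := sP h; subst h; first by [].
  + rewrite (mer (inl s) (inl (s ^+ 2)%g) _ s21) //;
      last by rewrite /= /fp_cons /= sq s21.
    rewrite (can (inl (s ^+ 2)%g)); last by rewrite /= /fp_cons /= s3' eqxx.
    rewrite !ext // Sw /F /kappa eqxx sE -(va (correction w)); ring.
  + rewrite (can (inl s)); last by rewrite /= /fp_cons /= s3 eqxx.
    rewrite (mer (inl (s ^+ 2)%g) (inl s) _ s1) //; last by rewrite /= /fp_cons /= s4 s1.
    rewrite !ext // Sw /F /kappa eqxx sE -(va2 (correction w)); ring.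
(* Exchanging a last letter [t] for [t ^+ 2] leaves the potential unchanged, so [vb] serves both
   cases. *)
- have [h1|hE|hE] := tP h; subst h; first by [].
  + rewrite (mer (inr t) (inr (t ^+ 2)%g) _ t21) //;
      last by rewrite /= /fp_cons /= sq t21.
    rewrite (can (inr (t ^+ 2)%g)); last by rewrite /= /fp_cons /= t3' eqxx.
    rewrite !ext // Sw /F /kappa eqxx sE -(vb (correction w)); ring.
  + rewrite (can (inr t)); last by rewrite /= /fp_cons /= t3 eqxx.
    rewrite (mer (inr (t ^+ 2)%g) (inr t) _ t1) //; last by rewrite /= /fp_cons /= t4 t1.
    rewrite !ext // Sw /F /kappa eqxx sE -(vb (correction w)); ring.
Qed.

End Potential.

(** * The drift formula, from the corrected length *)

Theorem mainTheorem6 (R : realType)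
    (s t : 'Z_3) (hs : generator [set: 'Z_3]%SET s) (ht : generator [set: 'Z_3]%SET t)
    (a b : free_product 'Z_3 'Z_3)
    (ha : a = fp_inl s) (hb : b = fp_inr t)
    (p q : R) (hp : 0 <= p) (hq : 0 <= q) (hpq0 : 0 < p + q) (hpq1 : p + q < 1)
    (mu : probability (free_product 'Z_3 'Z_3) R)
    (mu_a : mu [set a] = p%:E)
    (mu_a2 : mu [set (a ^+ 2)%g] = q%:E)
    (mu_b : mu [set b] = ((1 - p - q) / 2)%:E)
    (mu_b2 : mu [set (b ^+ 2)%g] = ((1 - p - q) / 2)%:E)
    (d : measure_display) (Omega : measurableType d) (P : probability Omega R)
    (x : nat -> {RV P >-> free_product 'Z_3 'Z_3})
    (hx : iid_of_law mu x) :
  has_drift P [set a; (a ^+ 2)%g; b; (b ^+ 2)%g] x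
    (2 * (1 - p - q) *
     Num.sqrt ((p ^+ 2 + q ^+ 2 + p * q) /
               (p ^+ 2 + q ^+ 2 - 2 * p * q + 3))).
Proof.
have [X [Y [Z [k [k' [e [[hX hY hZ] [va va2 vb v1]]]]]]]] :=
  potential_coefficients R p q hp hq hpq0 hpq1.
move: va va2 vb v1; set v := 2 * _ * Num.sqrt _; move=> va va2 vb v1.
have [C hC] := correction_bounded s X Y Z k k' e hX hY hZ.
have C0 : 0 <= C by apply: le_trans (hC [::]).
have [s1 s21 s2s _ sP] := Z3_generator s hs.
have [t1 t21 t2t _ tP] := Z3_generator t ht.
have aE : a = fp_letter (inl s) by [].
have a2E : (a ^+ 2)%g = fp_letter (inl (s ^+ 2)%g) by rewrite ha expgS expg1 -fp_inlM.
have bE : b = fp_letter (inr t) by [].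
have b2E : (b ^+ 2)%g = fp_letter (inr (t ^+ 2)%g) by rewrite hb expgS expg1 -fp_inrM.
pose S := [set a; (a ^+ 2)%g; b; (b ^+ 2)%g].
pose L := [:: a; (a ^+ 2)%g; b; (b ^+ 2)%g].
have wl g : word_length S g = size (val g).
  apply: word_length_fp => [[] h /= h1|g0 [[[->|->]|->]|->]].
  - case: (sP h) h1 => ->; rewrite ?eqxx // => _.
    + by rewrite -aE; do 3 left.
    + by rewrite -a2E; do 2 left; right.
  - case: (tP h) h1 => ->; rewrite ?eqxx // => _.
    + by rewrite -bE; left; right.
    + by rewrite -b2E; right.
  - by rewrite aE /= /fp_cons /= s1.
  - by rewrite a2E /= /fp_cons /= s21.
  - by rewrite bE /= /fp_cons /= t1.
  - by rewrite b2E /= /fp_cons /= t21.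
have letter_inj l m : fp_nontriv l -> fp_letter l = fp_letter m -> l = m.
  by move=> nl /(congr1 val); rewrite /= /fp_cons nl; case: ifP => // _ [].
have uL : uniq L.
  rewrite /L a2E b2E aE bE /= !inE !negb_or -!andbA.
  do ?[apply/andP; split] => //; apply/eqP => /letter_inj;
    rewrite /= ?s1 ?s21 ?t1 ?t21 => /(_ isT) // [] E.
  - by rewrite -E eqxx in s2s.
  - by rewrite -E eqxx in t2t.
pose f (g : free_product 'Z_3 'Z_3) := potential s X Y Z k k' e (val g).
have m1 : \sum_(l <- L) fine (mu [set l]) = 1.
  by rewrite !big_cons big_nil mu_a mu_a2 mu_b mu_b2 /=; field.
have fv g : \sum_(l <- L) fine (mu [set l]) * (f (g * l)%g - f g) = v.
  rewrite !big_cons big_nil mu_a mu_a2 mu_b mu_b2 /f a2E b2E aE bE addr0 !addrA.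
  rewrite !val_mul_fp_letter /= ?s1 ?s21 ?t1 ?t21 //.
  exact: potential_drift (valP g).
have S1 l : l \in L -> (size (val l) <= 1)%N.
  by rewrite !inE => /or4P[] /eqP ->; rewrite ?a2E ?b2E ?aE ?bE size_fp_letter.
(* The length changes by at most 1, because [g] is also [(g * l) * l^-1], and the correction by at
   most [C + C]. *)
have fC g l : l \in L -> `|f (g * l)%g - f g| <= 1 + (C + C).
  move=> /S1 l1.
  rewrite /f /potential opprD addrACA (le_trans (ler_normD _ _)) // lerD //; last first.
    by rewrite (le_trans (ler_normB _ _)) // lerD.
  have h1 : (size (val (g * l)%g) <= size (val g) + 1)%N.
    by apply: leq_trans (size_fp_mulw _ _) _; rewrite leq_add2l.
  have h2 : (size (val g) <= size (val (g * l)%g) + 1)%N.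
    rewrite -{1}[g](mulgK l); apply: leq_trans (size_fp_mulw _ _) _.
    by rewrite leq_add2l size_fp_inv.
  move: h1 h2; rewrite -!(ler_nat R) !natrD => h1 h2.
  by rewrite ler_norml lerBlDl h1 lerBrDr addrC lerBlDr h2.
have lln := random_walk_lln mu x hx L uL m1 f v _ fv fC.
apply: filterS lln => omega fn.
have cn := cvg_div_nat_bounded
  (fun n => correction s X Y Z k k' e (val (random_walk x n omega))) C (fun n => hC _).
have uv : f (random_walk x n omega) / n%:R -
    correction s X Y Z k k' e (val (random_walk x n omega)) / n%:R @[n --> \oo] --> v.
  by rewrite -[X in _ --> X]subr0; apply: cvgB fn cn.
apply: cvg_trans uv; apply: near_eq_cvg; apply: nearW => n.
by rewrite -mulrBl wl /f /potential addrK.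
Qed.
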